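(* Let $\mathcal{P}=\{1,\dots,p\}$, $\bm{X}_i\in\mathbb{R}^{n_i\times d}$ for $i\in\mathcal{P}$, $\bm{A}\in\mathbb{R}^{r\times d}$ with $\overline{\bm{A}}=\bm{A}-\frac1r\mathbf{1}_r\mathbf{1}_r^\top\bm{A}$ of full column rank, $\sigma\ge 0$, and $s\in\mathcal{P}$. Fix GDP parameters $\bm{O}_i\in\mathcal{O}(d)$, $\Psi_i\in\mathbb{R}^d$, $i\in\mathcal{P}$, and let $\bm{W}_i\in\mathbb{R}^{n_i\times d}$, $i\in\mathcal{P}$, be random matrices, all of whose entries are mutually independent standard Gaussian variables (the collection being jointly independent of the GDP parameters). Let $\bm{Z}^{\mathrm{AA}}$ be the aligned collaboration matrix produced by AA-I-GDP (private-data noise) with reference participant $s$ and noise matrices $\bm{W}_i$, and let $\bm{Z}^{\mathrm{C}}$ be the collaboration matrix produced by C-GDP (private-data noise) with the same $\sigma$ and common parameters $(\bm{O},\Psi)=(\bm{O}_s,\Psi_s)$. Then $\bm{Z}^{\mathrm{AA}}$ and $\bm{Z}^{\mathrm{C}}$ have the same distribution: $$\bm{Z}^{\mathrm{AA}}\overset{\mathrm{d}}{=}\bm{Z}^{\mathrm{C}}.$$ Moreover, for any fixed realization of the AA-I-GDP variables, under the coupling in which the standard Gaussian noise block used by C-GDP (private-data noise) for participant $i$ is $\widetilde{\bm{W}}_i=\bm{W}_i\bm{O}_i^\top\bm{O}_s$ for every $i\in\mathcal{P}$, one has $$\bm{Z}^{\mathrm{AA}}=\bm{Z}^{\mathrm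{C}}.$$
   Context: $\mathcal{O}(d)$ is the orthogonal group, $\mathbf{1}_m\in\mathbb{R}^m$ the all-ones column vector, $n=\sum_i n_i$, and $[\bm{M}_i]_{i\in\mathcal{P}}$ denotes vertical stacking. C-GDP (private-data noise) with common parameters $(\bm{O},\Psi)$: its collaboration matrix is $\bm{Z}^{\mathrm{C}}=[\bm{X}_i\bm{O}+\mathbf{1}_{n_i}\Psi^\top+\sigma\bm{W}^{\mathrm{C}}_i]_{i\in\mathcal{P}}\in\mathbb{R}^{n\times d}$, where the entries of $\bm{W}^{\mathrm{C}}_i\in\mathbb{R}^{n_i\times d}$, $i\in\mathcal{P}$, are mutually independent standard Gaussians, independent of $(\bm{O},\Psi)$. AA-I-GDP (private-data noise) with reference participant $s$: participant $i$ uploads $\bm{Y}_i=\bm{X}_i\bm{O}_i+\mathbf{1}_{n_i}\Psi_i^\top+\sigma\bm{W}_i$ and the noiseless $\bm{B}_i=\bm{A}\bm{O}_i+\mathbf{1}_r\Psi_i^\top$. The analyst computes $\bm{b}_i=\frac1r\bm{B}_i^\top\mathbf{1}_r$ and $\overline{\bm{B}}_i=\bm{B}_i-\mathbf{1}_r\bm{b}_i^\top$; for $i\neq s$ it takes a singular value decomposition $\overline{\bm{B}}_i^\top\overline{\bm{B}}_s=\bm{U}_i\bm{\Sigma}_i\bm{V}_i^\top$, sets $\bm{R}_i=\bm{U}_i\bm{V}_i^\top$, and defines, for any $m$ and $\bm{T}\in\mathbb{R}^{m\times d}$, $\mathcal{N}_i(\bm{T})=(\bm{T}-\mathbf{1}_m\bm{b}_i^\top)\bm{R}_i+\mathbf{1}_m\bm{b}_s^\top$;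 for $i=s$, $\mathcal{N}_s(\bm{T})=\bm{T}$. The aligned collaboration matrix is $\bm{Z}^{\mathrm{AA}}=[\mathcal{N}_i(\bm{Y}_i)]_{i\in\mathcal{P}}\in\mathbb{R}^{n\times d}$. *)

(* Defs.v *)
From HB Require Import structures.
From mathcomp Require Import all_boot all_order all_algebra.
From mathcomp Require Import all_classical all_reals all_analysis.

Set Implicit Arguments.
Unset Strict Implicit.
Unset Printing Implicit Defensive.

Import Order.TTheory GRing.Theory Num.Theory.
Import numFieldNormedType.Exports.

Local Open Scope classical_set_scope.
Local Open Scope ring_scope.

Section LinearAlgebra.
Variable R : realType.

Definition ones (m : nat) : 'cV[R]_m := const_mx 1.

Definition orthogonal_mx (d : nat) (O : 'M[R]_d) : Prop := O^T *m O = 1%:M.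

(* The order of the singular values is not part of the definition, so every
   ordering convention is covered. *)
Definition is_svd (d : nat) (M U S V : 'M[R]_d) : Prop :=
  [/\ orthogonal_mx U, orthogonal_mx V, is_diag_mx S,
      (forall i, 0 <= S i i) & M = U *m S *m V^T].

(* A - (1/r) 1 1^T A *)
Definition center_cols (r d : nat) (A : 'M[R]_(r, d)) : 'M[R]_(r, d) :=
  A - r%:R^-1 *: (ones r *m (ones r)^T *m A).

End LinearAlgebra.

Section Protocols.
Variable R : realType.

Definition gdp (m d : nat) (sigma : R) (X : 'M[R]_(m, d)) (O : 'M[R]_d)
    (Psi : 'cV[R]_d) (W : 'M[R]_(m, d)) : 'M[R]_(m, d) :=
  X *m O + ones R m *m Psi^T + sigma *: W.

Definition anchor_share (r d : nat) (A : 'M[R]_(r, d)) (O : 'M[R]_d)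
    (Psi : 'cV[R]_d) : 'M[R]_(r, d) :=
  A *m O + ones R r *m Psi^T.

Definition anchor_mean (r d : nat) (B : 'M[R]_(r, d)) : 'cV[R]_d :=
  r%:R^-1 *: (B^T *m ones R r).

Definition anchor_centered (r d : nat) (B : 'M[R]_(r, d)) : 'M[R]_(r, d) :=
  B - ones R r *m (anchor_mean B)^T.

Variables (p d r : nat) (n : 'I_p -> nat).

Definition Z_C (sigma : R) (X : forall i, 'M[R]_(n i, d)) (O : 'M[R]_d)
    (Psi : 'cV[R]_d) (W : forall i, 'M[R]_(n i, d)) : 'M[R]_(\sum_i n i, d) :=
  \mxcol_i gdp sigma (X i) O Psi (W i).

(* U i, S i, V i are the singular value decompositions the analyst picked, for
   i != s; the values at s are not constrained. *)
Definition analyst_svds (s : 'I_p) (B : 'I_p -> 'M[R]_(r, d))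
    (U S V : 'I_p -> 'M[R]_d) : Prop :=
  forall i, i != s ->
    is_svd ((anchor_centered (B i))^T *m anchor_centered (B s))
           (U i) (S i) (V i).

Definition align (s : 'I_p) (B : 'I_p -> 'M[R]_(r, d)) (U V : 'I_p -> 'M[R]_d)
    (i : 'I_p) (m : nat) (T : 'M[R]_(m, d)) : 'M[R]_(m, d) :=
  if i == s then T else
  (T - ones R m *m (anchor_mean (B i))^T) *m (U i *m (V i)^T)
  + ones R m *m (anchor_mean (B s))^T.

Definition Z_AA (s : 'I_p) (sigma : R) (X : forall i, 'M[R]_(n i, d))
    (A : 'M[R]_(r, d)) (O : 'I_p -> 'M[R]_d) (Psi : 'I_p -> 'cV[R]_d)
    (U V : 'I_p -> 'M[R]_d) (W : forall i, 'M[R]_(n i, d))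
    : 'M[R]_(\sum_i n i, d) :=
  \mxcol_i align s (fun j => anchor_share A (O j) (Psi j)) U V i
             (gdp sigma (X i) (O i) (Psi i) (W i)).

End Protocols.

Section Randomness.
Context {R : realType} {disp : measure_display} {T : measurableType disp}.
Variable P : probability T R.

Definition mutually_independent (I : finType) (Y : I -> T -> R) : Prop :=
  forall (J : {set I}) (B : I -> set R), (forall k, measurable (B k)) ->
    P (\bigcap_(k in [set` J]) (Y k @^-1` B k)) =
    (\prod_(k in J) P (Y k @^-1` B k))%E.

(* A single independent family ranges over all blocks and all their entries. *)
Definition std_gaussian_blocks (p d : nat) (n : 'I_p -> nat)
    (W : T -> forall i : 'I_p, 'M[R]_(n i, d)) : Prop :=
  let entry (k : {i : 'I_p & ('I_(n i) * 'I_d)%type}) (t : T) : R :=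
    W t (tag k) (tagged k).1 (tagged k).2 in
  [/\ forall k, measurable_fun [set: T] (entry k),
      forall k (B : set R), measurable B ->
        P (entry k @^-1` B) = normal_prob 0 1 B
    & mutually_independent entry].

End Randomness.

(* The product sigma-algebra on m x n matrices, generated by the entries; it is
   also the Borel sigma-algebra of the finite-dimensional matrix space. *)
Definition mx_measurable (R : realType) (m n : nat) : set (set 'M[R]_(m, n)) :=
  <<s [set C | exists i j (B : set R),
         measurable B /\ C = [set M : 'M[R]_(m, n) | B (M i j)]] >>.

Definition eq_distribution (R : realType) (m n : nat)
    (d1 d2 : measure_display)
    (T1 : measurableType d1) (T2 : measurableType d2)
    (P1 : probability T1 R) (P2 : probability T2 R)
    (Z1 : T1 -> 'M[R]_(m, n)) (Z2 : T2 -> 'M[R]_(m, n)) : Prop :=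
  forall B : set 'M[R]_(m, n), mx_measurable B ->
    P1 (Z1 @^-1` B) = P2 (Z2 @^-1` B).

(* Main.v *)
Require Import Defs.
From HB Require Import structures.
From mathcomp Require Import all_boot all_order all_algebra.
From mathcomp Require Import all_classical all_reals all_analysis.
From mathcomp Require Import measurable_realfun ring.
Set Implicit Arguments.
Unset Strict Implicit.
Unset Printing Implicit Defensive.
Import Order.TTheory GRing.Theory Num.Theory.
Import numFieldNormedType.Exports.
Local Open Scope classical_set_scope.
Local Open Scope ring_scope.

(** Writing [H = O_s^T Abar^T Abar O_s], which is positive definite, the analyst's
    matrix is [O_i^T O_s H], so uniqueness of the polar decomposition forces
    [R_i = U_i V_i^T = O_i^T O_s] whatever decomposition was chosen.  Alignment
    then sends [X_i O_i + 1 Psi_i^T + sigma W_i] to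
    [X_i O_s + 1 Psi_s^T + sigma W_i O_i^T O_s], which is the coupling.

    It remains to see that right multiplication by an orthogonal matrix preserves
    i.i.d. standard Gaussian rows.  Orthogonal matrices are products of plane
    rotations and coordinate sign changes, so only two coordinates move at a time.
    A plane rotation by an angle with nonzero sine is a product of three shears,
    which preserve planar Lebesgue measure by Tonelli and translation invariance,
    and the planar Gaussian density is rotation invariant. *)

(** * Polar factors and the deterministic alignment identity *)

Section RealMatrices.
Variable R : realType.

Lemma trmx_mul_trace (m n : nat) (N : 'M[R]_(m, n)) :
  \tr (N^T *m N) = \sum_j \sum_i N i j ^+ 2.
Proof.
apply: eq_bigr => j _; rewrite mxE; apply: eq_bigr => i _.
by rewrite mxE expr2.
Qed.

Lemma trmx_mul_trace_le0 (m n : nat) (N : 'M[R]_(m, n)) :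
  \tr (N^T *m N) <= 0 -> N = 0.
Proof.
rewrite trmx_mul_trace => le0.
have ge0 j : 0 <= \sum_i N i j ^+ 2 by apply: sumr_ge0 => i _; exact: sqr_ge0.
have /psumr_eq0P sum0 : \sum_j \sum_i N i j ^+ 2 = 0.
  by apply/eqP; rewrite eq_le le0 sumr_ge0.
apply/matrixP => i j; rewrite mxE.
have /psumr_eq0P Nj0 : \sum_i N i j ^+ 2 = 0 by apply: sum0.
by apply/eqP; rewrite -sqrf_eq0 Nj0// => k _; exact: sqr_ge0.
Qed.

Lemma trmx_mul_eq0 (m n : nat) (N : 'M[R]_(m, n)) : N^T *m N = 0 -> N = 0.
Proof. by move=> N0; apply: trmx_mul_trace_le0; rewrite N0 mxtrace0. Qed.

Lemma tr_is_diag_mx (d : nat) (S : 'M[R]_d) : is_diag_mx S -> S^T = S.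
Proof. by case/diag_mxP => v ->; exact: tr_diag_mx. Qed.

Lemma orthogonal_mxC (d : nat) (O : 'M[R]_d) :
  orthogonal_mx O -> O *m O^T = 1%:M.
Proof. exact: mulmx1C. Qed.

Lemma orthogonal_mxM (d : nat) (O Q : 'M[R]_d) :
  orthogonal_mx O -> orthogonal_mx Q -> orthogonal_mx (O *m Q).
Proof.
move=> hO hQ; rewrite /orthogonal_mx trmx_mul mulmxA -(mulmxA Q^T) hO mulmx1.
exact: hQ.
Qed.

Lemma orthogonal_mxT (d : nat) (O : 'M[R]_d) :
  orthogonal_mx O -> orthogonal_mx O^T.
Proof. by move=> hO; rewrite /orthogonal_mx trmxK; exact: orthogonal_mxC. Qed.

(* With [D] the difference of the two factors [B^T B] and [V S V^T], equality of
   the squares gives [tr (D B^T B D) + tr (D V S V^T D) = 0], a sum of two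
   nonnegative terms, so [B D = 0]. *)
Lemma gram_svd_eq (r d : nat) (B : 'M[R]_(r, d)) (V S : 'M[R]_d) :
  \rank B = d -> is_diag_mx S -> (forall i, 0 <= S i i) ->
  let H := B^T *m B in let K := V *m S *m V^T in
  H *m H = K *m K -> H = K.
Proof.
move=> rB dS S0 H K HK; set D : 'M[R]_d := H - K.
have Bfree : row_free B^T by rewrite /row_free mxrank_tr rB.
have ST := tr_is_diag_mx dS.
have HT : H^T = H by rewrite /H trmx_mul trmxK.
have KT : K^T = K by rewrite /K !trmx_mul trmxK ST mulmxA.
have DT : D^T = D by rewrite /D linearB /= HT KT.
have DHK : H *m D + D *m K = 0.
  by rewrite /D mulmxBr mulmxBl HK addrA subrK subrr.
have tr0 : \tr ((B *m D)^T *m (B *m D)) + \tr (D *m K *m D) = 0.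
  rewrite trmx_mul DT -(mulmxA D B^T) (mulmxA B^T) -/H (mxtrace_mulC (D *m K)).
  by rewrite -mxtraceD -mulmxDr DHK mulmx0 mxtrace0.
have trK : 0 <= \tr (D *m K *m D).
  have -> : D *m K *m D = (V^T *m D)^T *m S *m (V^T *m D).
    by rewrite trmx_mul trmxK DT /K !mulmxA.
  apply: sumr_ge0 => i _; rewrite mxE; apply: sumr_ge0 => j _.
  rewrite mxE (bigD1 j)//= big1 ?addr0; last first.
    by move=> k kj; move/is_diag_mxP: dS => ->//; rewrite mulr0.
  by rewrite mxE mulrAC -expr2 mulr_ge0// sqr_ge0.
have BD0 : B *m D = 0.
  by apply: trmx_mul_trace_le0; rewrite -(lerD2r (\tr (D *m K *m D))) tr0 add0r.
apply/eqP; rewrite -subr_eq0 -/D; apply/eqP.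
apply: (row_free_inj Bfree).
by rewrite mul0mx -DT -trmx_mul BD0 trmx0.
Qed.

(** Any decomposition regroups as [(U *m V^T) *m (V *m S *m V^T)], a second polar decomposition of
    the same matrix. Taking Gram matrices removes the orthogonal factors, so both symmetric factors
    have the same square and [gram_svd_eq] identifies them; cancelling them leaves the orthogonal
    factors equal, even though [U] and [V] separately are not determined. *)
Lemma polar_factor_svd (r d : nat) (B : 'M[R]_(r, d)) (Q U S V : 'M[R]_d) :
  \rank B = d -> orthogonal_mx Q -> is_svd (Q *m (B^T *m B)) U S V ->
  U *m V^T = Q.
Proof.
move=> rB hQ [hU hV dS S0 eM].
set H := B^T *m B in eM *; set K := V *m S *m V^T.
have HT : H^T = H by rewrite /H trmx_mul trmxK.
have ST := tr_is_diag_mx dS.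
have KT : K^T = K by rewrite /K !trmx_mul trmxK ST mulmxA.
have QHK : Q *m H = U *m V^T *m K.
  by rewrite eM /K !mulmxA -(mulmxA U _ V) hV mulmx1.
have HK : H = K.
  apply: gram_svd_eq => //; rewrite -/H -/K.
  transitivity ((Q *m H)^T *m (Q *m H)).
    by rewrite trmx_mul HT mulmxA -(mulmxA H) hQ mulmx1.
  have hW := orthogonal_mxM hU (orthogonal_mxT hV).
  by rewrite QHK trmx_mul KT mulmxA -(mulmxA K _ (U *m _)) hW mulmx1.
(* Cancellation without inverting [H]: since [Q - U *m V^T] annihilates [H = B^T *m B], the Gram
   matrix of [B *m (Q - U *m V^T)^T] vanishes. Then [B^T], being row free, cancels too. *)
have : (Q - U *m V^T) *m B^T = 0.
  apply: trmx_inj; rewrite trmx0; apply: trmx_mul_eq0.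
  rewrite trmxK trmx_mul trmxK mulmxA -(mulmxA (Q - _)) -/H.
  by rewrite mulmxBl QHK -HK subrr mul0mx.
rewrite -[RHS](mul0mx _ B^T) => /row_free_inj.
rewrite /row_free mxrank_tr rB eqxx => /(_ isT) /eqP.
by rewrite subr_eq0 => /eqP.
Qed.

Lemma anchor_mean_share (r d : nat) (A : 'M[R]_(r, d)) (O : 'M[R]_d)
    (Psi : 'cV[R]_d) : (0 < r)%N ->
  anchor_mean (anchor_share A O Psi) = O^T *m anchor_mean A + Psi.
Proof.
move=> r0; rewrite /anchor_mean /anchor_share linearD /= !trmx_mul trmxK.
rewrite mulmxDl scalerDr -scalemxAr mulmxA; congr (_ + _).
rewrite -mulmxA.
have -> : (ones R r)^T *m ones R r = r%:R%:M.
  apply/matrixP => i j; rewrite !ord1 !mxE /= mulr1n.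
  rewrite (eq_bigr (fun=> 1)) ?sumr_const ?card_ord// => k _.
  by rewrite !mxE mulr1.
rewrite mul_mx_scalar scalerA mulVf ?scale1r//.
by rewrite pnatr_eq0 -lt0n.
Qed.

Lemma anchor_centered_share (r d : nat) (A : 'M[R]_(r, d)) (O : 'M[R]_d)
    (Psi : 'cV[R]_d) :
  anchor_centered (anchor_share A O Psi) = center_cols A *m O.
Proof.
(* The mean formula divides by [r]; for [r = 0] there are no entries to compare. *)
case: r A => [|r] A; first by apply/matrixP => -[].
rewrite /anchor_centered anchor_mean_share// linearD /= trmx_mul trmxK.
rewrite /anchor_share /center_cols mulmxDr opprD addrACA subrr addr0 mulmxBl.
congr (_ - _); rewrite /anchor_mean linearZ /= trmx_mul trmxK.
by rewrite -!scalemxAl -scalemxAr !mulmxA.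
Qed.

(** Subtracting the mean of share [i] removes [Psi i] and leaves the data centred at the anchor
    mean, still rotated by [O i]. The rotation trades [O i] for [O s], and adding the mean of share
    [s] cancels the anchor mean and brings in [Psi s]. *)
Lemma align_gdp (r d p m : nat) (A : 'M[R]_(r, d)) (s i : 'I_p) (sigma : R)
    (X W : 'M[R]_(m, d)) (O U V : 'I_p -> 'M[R]_d) (Psi : 'I_p -> 'cV[R]_d) :
  (0 < r)%N -> (forall j, orthogonal_mx (O j)) ->
  (i != s -> U i *m (V i)^T = (O i)^T *m O s) ->
  align s (fun j => anchor_share A (O j) (Psi j)) U V i
    (gdp sigma X (O i) (Psi i) W) =
  gdp sigma X (O s) (Psi s) (W *m (O i)^T *m O s).
Proof.
move=> r0 hO hUV; rewrite /align; have [->|/hUV ->] := eqVneq i s.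
  by rewrite -mulmxA hO mulmx1.
have -> : gdp sigma X (O i) (Psi i) W -
      ones R m *m (anchor_mean (anchor_share A (O i) (Psi i)))^T =
    (X - ones R m *m (anchor_mean A)^T) *m O i + sigma *: W.
  rewrite anchor_mean_share// linearD /= trmx_mul trmxK mulmxDr mulmxBl /gdp.
  rewrite -mulmxA; apply/matrixP => k l.
  by rewrite !mxE; ring.
rewrite anchor_mean_share// linearD /= trmx_mul trmxK mulmxDr mulmxDl.
rewrite mulmxA -(mulmxA _ (O i)) orthogonal_mxC// mulmx1 mulmxBl -scalemxAl.
rewrite /gdp !mulmxA; apply/matrixP => k l.
by rewrite !mxE; ring.
Qed.

Lemma analyst_rotation (r d p : nat) (A : 'M[R]_(r, d)) (s i : 'I_p)
    (O U S V : 'I_p -> 'M[R]_d) (Psi : 'I_p -> 'cV[R]_d) :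
  \rank (center_cols A) = d -> (forall j, orthogonal_mx (O j)) ->
  analyst_svds s (fun j => anchor_share A (O j) (Psi j)) U S V ->
  i != s -> U i *m (V i)^T = (O i)^T *m O s.
Proof.
move=> rA hO hsvd /hsvd; rewrite !anchor_centered_share.
have Ou : O s \in unitmx by have [] := mulmx1_unit (hO s).
(* Inserting [O s *m (O s)^T = 1] exhibits the analyst's matrix as an orthogonal factor times a Gram
   matrix. *)
have -> : (center_cols A *m O i)^T *m (center_cols A *m O s) =
    (O i)^T *m O s *m ((center_cols A *m O s)^T *m (center_cols A *m O s)).
  rewrite !trmx_mul !mulmxA -(mulmxA (O i)^T) orthogonal_mxC//.
  by rewrite mulmx1.
apply: polar_factor_svd; first by rewrite mxrankMfree// row_free_unit.
exact/orthogonal_mxM/hO/orthogonal_mxT/hO.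
Qed.

Lemma Z_AA_coupling (r d p : nat) (n : 'I_p -> nat) (A : 'M[R]_(r, d))
    (s : 'I_p) (sigma : R) (X W : forall i, 'M[R]_(n i, d))
    (O U S V : 'I_p -> 'M[R]_d) (Psi : 'I_p -> 'cV[R]_d) :
  \rank (center_cols A) = d -> (forall j, orthogonal_mx (O j)) ->
  analyst_svds s (fun j => anchor_share A (O j) (Psi j)) U S V ->
  Z_AA s sigma X A O Psi U V W =
  Z_C sigma X (O s) (Psi s) (fun i => W i *m (O i)^T *m O s).
Proof.
move=> rA hO hsvd; apply: eq_mxcol => i.
have [r0|r0] := posnP r; last first.
  by apply: align_gdp => // /(analyst_rotation rA hO hsvd).
(* With an empty anchor, full column rank forces [d = 0], so the matrices have no columns. *)
have dr : (d <= r)%N by rewrite -rA rank_leq_row.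
apply/matrixP => k l.
by have := leq_trans (ltn_ord l) dr; rewrite [X in (_ < X)%N]r0.
Qed.

End RealMatrices.

(** * Rotation invariance of the planar standard Gaussian *)

Section LebesguePlane.
Context {R : realType}.
Local Notation TR := (measurableTypeR R).
Local Notation mu := (@lebesgue_measure R).

Lemma lebesgue_measure_shift (c : R) (A : set R) : measurable A ->
  mu ((fun x : R => x + c) @^-1` A) = mu A.
Proof.
move=> mA.
have mf : measurable_fun [set: measurableTypeR R]
    ((fun x : R => x + c) : measurableTypeR R -> measurableTypeR R).
  by apply: measurable_funD.
rewrite -[LHS]/(pushforward mu ((fun x : R => x + c) : TR -> TR) A).
apply/esym/lebesgue_measure_unique => //= _ [[a b]] _ <-.
rewrite /pushforward (_ : _ @^-1` _ = `]a - c, b - c]%classic); last first.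
  by apply/seteqP; split => x /=; rewrite !in_itv/= ltrBlDr lerBrDr.
rewrite !lebesgue_measure_itv/= !lte_fin ltrD2r.
by case: ifP => // _; rewrite -!EFinD; congr EFin; ring.
Qed.

(** Allows slicing in either direction: [shear2] translates vertical sections, [shear1] horizontal
    ones. *)
Lemma lebesgue2_sym (C : set (TR * TR)) : measurable C ->
  (mu \x mu)%E C = (mu \x^ mu)%E C.
Proof.
move=> mC; apply: product_measure_unique => //= A B mA mB.
by rewrite product_measure2E.
Qed.

Definition shear1 (a : R) (z : TR * TR) : TR * TR := (z.1 + a * z.2, z.2).
Definition shear2 (a : R) (z : TR * TR) : TR * TR := (z.1, z.2 + a * z.1).

Lemma measurable_shear1 a : measurable_fun [set: TR * TR] (shear1 a).
Proof.
apply: measurable_fun_pair => //.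
by apply: measurable_funD => //; apply: measurable_funM.
Qed.

Lemma measurable_shear2 a : measurable_fun [set: TR * TR] (shear2 a).
Proof.
apply: measurable_fun_pair => //.
by apply: measurable_funD => //; apply: measurable_funM.
Qed.

Lemma lebesgue2_shear2 a (C : set (TR * TR)) : measurable C ->
  (mu \x mu)%E (shear2 a @^-1` C) = (mu \x mu)%E C.
Proof.
move=> mC; apply: eq_integral => x _ /=.
rewrite -(lebesgue_measure_shift (a * x) (measurable_xsection x mC)).
by congr (mu _); apply/seteqP; split => y; rewrite /xsection /= !inE.
Qed.

Lemma lebesgue2_shear1 a (C : set (TR * TR)) : measurable C ->
  (mu \x mu)%E (shear1 a @^-1` C) = (mu \x mu)%E C.
Proof.
move=> mC; rewrite !lebesgue2_sym//; last first.
  by rewrite -[X in measurable X]setTI; exact: measurable_shear1.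
apply: eq_integral => y _ /=.
rewrite -(lebesgue_measure_shift (a * y) (measurable_ysection y mC)).
by congr (mu _); apply/seteqP; split => x; rewrite /ysection /= !inE.
Qed.

Definition rotation (c s : R) (z : TR * TR) : TR * TR :=
  (c * z.1 + s * z.2, - s * z.1 + c * z.2).

(** For [c] and [s] the cosine and sine of an angle, [(1 - c) / s] is the tangent of half the
    angle. *)
Lemma rotation_shears (c s : R) : s != 0 -> c ^+ 2 + s ^+ 2 = 1 ->
  rotation c s =
  shear1 ((1 - c) / s) \o shear2 (- s) \o shear1 ((1 - c) / s).
Proof.
move=> s0 cs; apply/funext => -[x y]; rewrite /rotation /shear1 /shear2 /=.
have s2 : s ^+ 2 = 1 - c ^+ 2 by rewrite -cs; ring.
congr pair.
  (* The added zero is the multiple of the constraint [c ^+ 2 + s ^+ 2 = 1] that turns the goal into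
     an identity valid for all [c] and all nonzero [s]. *)
  transitivity (c * x + s * y + 0 * y); first by ring.
  have -> : 0 * y = (1 - c ^+ 2 - s ^+ 2) / s * y by rewrite s2 subrr !mul0r.
  by field.
by field.
Qed.

Lemma measurable_rotation (c s : R) : measurable_fun [set: TR * TR] (rotation c s).
Proof.
apply: measurable_fun_pair;
  by apply: measurable_funD; apply: measurable_funM => //; exact: measurable_cst.
Qed.

Lemma lebesgue2_rotation (c s : R) (C : set (TR * TR)) :
  s != 0 -> c ^+ 2 + s ^+ 2 = 1 -> measurable C ->
  (mu \x mu)%E (rotation c s @^-1` C) = (mu \x mu)%E C.
Proof.
move=> s0 cs mC; rewrite rotation_shears// !comp_preimage.
set k := _ / _.
have m1 : measurable (shear1 k @^-1` C).
  by rewrite -[X in measurable X]setTI; exact: measurable_shear1.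
rewrite lebesgue2_shear1; last first.
  by rewrite -[X in measurable X]setTI; exact: measurable_shear2.
by rewrite lebesgue2_shear2// lebesgue2_shear1.
Qed.

Local Notation gauss := (@normal_prob R 0 1).

Definition gauss2_pdf (z : TR * TR) : R := normal_pdf 0 1 z.1 * normal_pdf 0 1 z.2.

Lemma gauss2_pdf_ge0 z : 0 <= gauss2_pdf z.
Proof. by rewrite mulr_ge0// normal_pdf_ge0. Qed.

Lemma measurable_gauss2_pdf : measurable_fun [set: TR * TR] gauss2_pdf.
Proof.
by apply: measurable_funM; apply: measurableT_comp => //; exact: measurable_normal_pdf.
Qed.

Lemma gauss2_pdf_rotation (c s : R) z : c ^+ 2 + s ^+ 2 = 1 ->
  gauss2_pdf (rotation c s z) = gauss2_pdf z.
Proof.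
move=> cs; rewrite /gauss2_pdf !normal_pdfE ?oner_eq0//= /normal_fun !subr0.
rewrite [LHS]mulrACA [RHS]mulrACA -!expRD; congr (_ * expR _).
transitivity (- ((c ^+ 2 + s ^+ 2) * (z.1 ^+ 2 + z.2 ^+ 2)) / (1 ^+ 2 *+ 2)).
  by rewrite /rotation /=; ring.
by rewrite cs; ring.
Qed.

(** The planar Gaussian as a density against Lebesgue measure, the form suited to a change of
    variables; it agrees with the product law on rectangles, hence everywhere. *)
Definition gauss2 (C : set (TR * TR)) : \bar R :=
  (\int[mu \x mu]_(z in C) (gauss2_pdf z)%:E)%E.

Lemma gauss2_set0 : gauss2 set0 = 0%E.
Proof. exact: integral_set0. Qed.

Lemma gauss2_ge0 C : (0 <= gauss2 C)%E.
Proof. by apply: integral_ge0 => z _; rewrite lee_fin gauss2_pdf_ge0. Qed.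

Lemma gauss2_sigma_additive : semi_sigma_additive gauss2.
Proof.
move=> F mF tF mUF.
rewrite /gauss2 ge0_integral_bigcup//.
- by apply: is_cvg_ereal_nneg_natsum_cond => n _ _; exact: gauss2_ge0.
- by apply: measurable_funTS; apply/measurable_EFinP; exact: measurable_gauss2_pdf.
- by move=> z _; rewrite lee_fin gauss2_pdf_ge0.
Qed.

HB.instance Definition _ := isMeasure.Build _ _ _
  gauss2 gauss2_set0 gauss2_ge0 gauss2_sigma_additive.

Lemma gauss2_rectangle (A B : set R) : measurable A -> measurable B ->
  gauss2 (A `*` B) = (gauss A * gauss B)%E.
Proof.
move=> mA mB.
have mpdf (D : set R) : measurable_fun D (fun x : R => (normal_pdf 0 1 x)%:E).
  by apply/measurable_EFinP/measurable_funTS; exact: measurable_normal_pdf.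
have pdf_ge0 (x : R) : (0 <= (normal_pdf 0 1 x)%:E :> \bar R)%E.
  by rewrite lee_fin normal_pdf_ge0.
rewrite /gauss2 integral_mkcond fubini_tonelli1; last 2 first.
- apply/(measurable_restrictT _ _).1; first exact: measurableX.
  by apply: measurable_funTS; apply/measurable_EFinP; exact: measurable_gauss2_pdf.
- by move=> z; apply: erestrict_ge0 => {}z _; rewrite lee_fin gauss2_pdf_ge0.
transitivity (\int[mu]_(x in A) ((normal_pdf 0 1 x)%:E * gauss B))%E; last first.
  by rewrite ge0_integralZr//; exact: mpdf.
rewrite [RHS]integral_mkcond; apply: eq_integral => x _.
rewrite /fubini_F patchE; have [xA|xA] := boolP (x \in A); last first.
  by rewrite integral0_eq// => y _; rewrite patchE in_setX (negbTE xA).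
rewrite /= /normal_prob -ge0_integralZl//; last exact: mpdf.
rewrite [RHS]integral_mkcond; apply: eq_integral => y _.
by rewrite !patchE in_setX /= xA.
Qed.

Lemma gauss_prod_rotation (c s : R) (C : set (TR * TR)) :
  s != 0 -> c ^+ 2 + s ^+ 2 = 1 -> measurable C ->
  (gauss \x gauss)%E (rotation c s @^-1` C) = (gauss \x gauss)%E C.
Proof.
move=> s0 cs mC.
have mrC : measurable (rotation c s @^-1` C).
  by rewrite -[X in measurable X]setTI; exact: measurable_rotation.
have prodE D : measurable D -> (gauss \x gauss)%E D = gauss2 D.
  move=> mD.
  apply: (@product_measure_unique _ _ _ _ _ gauss gauss gauss2 _ D mD).
  exact: gauss2_rectangle.
rewrite (prodE _ mrC) (prodE _ mC) /gauss2.
(* Lebesgue measure is its own image under the rotation, so the integral can be pulled back, and the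
   density does not change along the way. *)
transitivity (\int[pushforward (mu \x mu)%E (rotation c s)]_(z in C)
    (gauss2_pdf z)%:E)%E; last first.
  apply: eq_measure_integral; first exact: measurable_rotation.
  by move=> mf A mA _; exact: lebesgue2_rotation.
rewrite ge0_integral_pushforward//=.
- by apply: eq_integral => z _ /=; rewrite gauss2_pdf_rotation.
- exact: measurable_rotation.
- by apply: measurable_funTS; apply/measurable_EFinP; exact: measurable_gauss2_pdf.
- by move=> z _; rewrite lee_fin gauss2_pdf_ge0.
Qed.

End LebesguePlane.

(** * Generation of the orthogonal group by plane rotations and sign changes *)

Section OrthogonalGeneration.
Variables (R : realType) (d : nat).

(** Laid out by columns so that right multiplication applies [rotation c s] to the coordinates [a],
    [b] of a row vector. *)
Definition plane_rot (a b : 'I_d) (c s : R) : 'M[R]_d :=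
  \matrix_(i, j)
    (if j == a then c *+ (i == a) + s *+ (i == b)
     else if j == b then c *+ (i == b) - s *+ (i == a) else (i == j)%:R).

Definition axis_flip (a : 'I_d) : 'M[R]_d :=
  \matrix_(i, j) ((-1) ^+ (j == a) *+ (i == j)).

Lemma sum_mul_delta (I : finType) (v : I -> R) (a : I) (x : R) :
  \sum_i v i * (x *+ (i == a)) = v a * x.
Proof.
rewrite (bigD1 a)//= eqxx big1 ?addr0// => i /negPf ->.
by rewrite mulr0n mulr0.
Qed.

Lemma sum_mul_plane_rot (v : 'I_d -> R) (a b j : 'I_d) (c s : R) :
  \sum_i v i * plane_rot a b c s i j =
  if j == a then c * v a + s * v b
  else if j == b then - s * v a + c * v b else v j.
Proof.
under eq_bigr do rewrite mxE.
case: ifP => _.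
  under eq_bigr do rewrite mulrDr.
  by rewrite big_split /= !sum_mul_delta; ring.
case: ifP => _; last by rewrite sum_mul_delta mulr1.
under eq_bigr do rewrite -mulNrn mulrDr.
by rewrite big_split /= !sum_mul_delta; ring.
Qed.

Lemma sum_mul_axis_flip (v : 'I_d -> R) (a j : 'I_d) :
  \sum_i v i * axis_flip a i j = if j == a then - v a else v j.
Proof.
under eq_bigr do rewrite mxE.
rewrite sum_mul_delta; have [->|_] := eqVneq j a.
  by rewrite expr1 mulrN1.
by rewrite expr0 mulr1.
Qed.

Lemma mulmx_plane_rot (Q : 'M[R]_d) (a b i j : 'I_d) (c s : R) :
  (Q *m plane_rot a b c s) i j =
  if j == a then c * Q i a + s * Q i b
  else if j == b then - s * Q i a + c * Q i b else Q i j.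
Proof. by rewrite mxE sum_mul_plane_rot. Qed.

Lemma mulmx_axis_flip (Q : 'M[R]_d) (a i j : 'I_d) :
  (Q *m axis_flip a) i j = if j == a then - Q i a else Q i j.
Proof. by rewrite mxE sum_mul_axis_flip. Qed.

Lemma plane_rotK (a b : 'I_d) (c s : R) : a != b -> c ^+ 2 + s ^+ 2 = 1 ->
  plane_rot a b c s *m plane_rot a b c (- s) = 1%:M.
Proof.
move=> ab cs; apply/matrixP => i j; rewrite mulmx_plane_rot.
have ba : (b == a) = false by rewrite eq_sym (negPf ab).
rewrite ![plane_rot _ _ _ _ _ _]mxE !eqxx ba mxE.
have [->|ja] := eqVneq j a.
  by rewrite -cs; case: (i == a); case: (i == b); ring.
have [->|jb] := eqVneq j b; last by [].
by rewrite -cs; case: (i == a); case: (i == b); ring.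
Qed.

Lemma axis_flipK (a : 'I_d) : axis_flip a *m axis_flip a = 1%:M.
Proof.
apply/matrixP => i j; rewrite mulmx_axis_flip !mxE.
have [->|ja] := eqVneq j a; rewrite ?eqxx ?(negPf ja) ?expr0//.
by rewrite expr1 mulNrn opprK.
Qed.

Lemma axis_flipT (a : 'I_d) : (axis_flip a)^T = axis_flip a.
Proof.
by apply/matrixP => i j; rewrite !mxE; have [->|] := eqVneq i j; rewrite ?eqxx.
Qed.

Lemma orthogonal_plane_rot (a b : 'I_d) (c s : R) :
  a != b -> c ^+ 2 + s ^+ 2 = 1 -> orthogonal_mx (plane_rot a b c s).
Proof.
move=> ab cs; have ba : (b == a) = false by rewrite eq_sym (negPf ab).
apply/matrixP => i j; rewrite mxE; under eq_bigr do rewrite mxE.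
rewrite sum_mul_plane_rot !mxE !eqxx ba (negPf ab) !(eq_sym _ i).
have [->|ja] := eqVneq j a.
  case: (eqVneq i a) => [_|_]; first by rewrite -cs /=; ring.
  by case: (eqVneq i b) => _ /=; ring.
have [->|jb] := eqVneq j b.
  have [->|_] := eqVneq i a; first by rewrite (negPf ab) /=; ring.
  case: (eqVneq i b) => [_|_]; first by rewrite -cs /=; ring.
  by rewrite /=; ring.
have [->|_] := eqVneq i a; first by rewrite eq_sym (negPf ja) /=; ring.
by have [->|//] := eqVneq i b; rewrite eq_sym (negPf jb) /=; ring.
Qed.

Lemma orthogonal_axis_flip (a : 'I_d) : orthogonal_mx (axis_flip a).
Proof. by rewrite /orthogonal_mx axis_flipT axis_flipK. Qed.

Lemma orthogonal_row_dot (Q : 'M[R]_d) (i k : 'I_d) : orthogonal_mx Q ->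
  \sum_j Q i j * Q k j = (i == k)%:R.
Proof.
move=> /orthogonal_mxC /matrixP /(_ i k); rewrite !mxE => <-.
by apply: eq_bigr => j _; rewrite mxE.
Qed.

Lemma orthogonal_generation (Pr : 'M[R]_d -> Prop) :
  Pr 1%:M ->
  (forall A B, Pr A -> Pr B -> Pr (A *m B)) ->
  (forall a b c s, a != b -> s != 0 -> c ^+ 2 + s ^+ 2 = 1 ->
    Pr (plane_rot a b c s)) ->
  (forall a, Pr (axis_flip a)) ->
  forall Q, orthogonal_mx Q -> Pr Q.
Proof.
(* Givens elimination: once the first [k] rows agree with those of the identity,
   orthonormality makes the first [k] entries of row [k] vanish; rotations in the
   planes [(k, b)] then clear its remaining off-diagonal entries one by one,
   which leaves [+1] or [-1] on the diagonal. *)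
move=> Pr1 PrM Prot Pflip.
pose fixes (k : nat) (Q : 'M[R]_d) :=
  forall i j : 'I_d, (i < k)%N -> Q i j = (i == j)%:R.
suff main m : forall k Q, (k + m)%N = d -> fixes k Q -> orthogonal_mx Q -> Pr Q.
  by move=> Q; apply: (main d 0%N).
elim: m => [k Q kd fQ _|m IHm k Q kd fQ hQ].
  suff -> : Q = 1%:M by [].
  by apply/matrixP => i j; rewrite mxE fQ//; rewrite addn0 in kd; rewrite kd.
have k_lt_d : (k < d)%N by rewrite -kd addnS ltnS leq_addr.
pose k' := Ordinal k_lt_d.
have [N leN] := ubnP #|[pred j | (j != k') && (Q k' j != 0)]|.
elim: N Q leN fQ hQ => // N IHN Q leN fQ hQ.
(* Row [i] is already a unit vector, so its inner product with row [j] reads off [Q j i]. *)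
have fQk' (i j : 'I_d) : (i < k)%N -> Q j i = (i == j)%:R.
  move=> ik; rewrite -(orthogonal_row_dot i j hQ) (bigD1 i)//= (fQ i)// eqxx mul1r.
  rewrite big1 ?addr0// => l li.
  by rewrite (fQ i)// eq_sym (negPf li) mul0r.
have [b /andP[bk Qb]|row0] := pickP [pred j | (j != k') && (Q k' j != 0)].
  set u := Q k' k'; set v := Q k' b in Qb.
  have uv0 : 0 < u ^+ 2 + v ^+ 2.
    by rewrite ltr_wpDl ?sqr_ge0// lt0r sqr_ge0 sqrf_eq0 Qb.
  set rho := Num.sqrt (u ^+ 2 + v ^+ 2).
  have rho0 : rho != 0 by rewrite gt_eqF// sqrtr_gt0.
  have rho2 : rho ^+ 2 = u ^+ 2 + v ^+ 2 by rewrite sqr_sqrtr// ltW.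
  (* The unit vector along [(u, v)]: this rotation sends the pair to [(rho, 0)], and [v != 0] gives
     the nonzero sine. *)
  set c := u / rho; set s := v / rho.
  have cs : c ^+ 2 + s ^+ 2 = 1.
    by rewrite !expr_div_n -mulrDl -rho2 divff// expf_neq0.
  have s0 : s != 0 by rewrite mulf_neq0// invr_eq0.
  have kb : k' != b by rewrite eq_sym.
  have -> : Q = Q *m plane_rot k' b c s *m plane_rot k' b c (- s).
    by rewrite -mulmxA plane_rotK// mulmx1.
  apply: PrM; last by apply: Prot; rewrite ?oppr_eq0 ?sqrrN.
  apply: IHN; last exact/orthogonal_mxM/orthogonal_plane_rot.
    rewrite -ltnS (leq_trans _ leN)// ltnS; apply: proper_card.
    apply/properP; split.
      apply/fintype.subsetP => j; rewrite !inE mulmx_plane_rot => /andP[jk].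
      rewrite (negPf jk) /=; case: (eqVneq j b) => [->|//].
      by rewrite -/v Qb.
    exists b; first by rewrite !inE bk.
    rewrite !inE mulmx_plane_rot (negPf bk) eqxx negb_and; apply/orP; right.
    by apply/negPn/eqP; rewrite -/u -/v /c /s; field.
  move=> i j ik; rewrite mulmx_plane_rot.
  have ik' : (i == k') = false by apply/negbTE; rewrite -val_eqE /= ltn_eqF.
  (* Row [k'] vanishes at the earlier indices, so [b] is not one of them and the rotation preserves
     the rows already treated. *)
  have ib : (i == b) = false.
    by apply/negbTE/eqP => ib; move: Qb; rewrite /v -ib fQk'// ik' eqxx.
  rewrite !fQ// ik' ib !mulr0 addr0.
  by case: eqVneq => [->|_]; [rewrite ik'|case: eqVneq => [->|//]; rewrite ib].
have Qk j : j != k' -> Q k' j = 0.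
  by move=> jk; move: (row0 j); rewrite /= jk /= => /negbFE /eqP.
have : Q k' k' ^+ 2 = 1.
  have := orthogonal_row_dot k' k' hQ; rewrite eqxx (bigD1 k')//= big1 ?addr0//.
  by move=> j jk; rewrite Qk// mul0r.
have kdS : (k.+1 + m)%N = d by rewrite addSnnS.
move/eqP; rewrite sqrf_eq1 => /orP[] /eqP Qkk.
  apply: (IHm _ _ kdS) => // i j; rewrite ltnS leq_eqVlt => /predU1P[ik|/fQ//].
  have -> : i = k' by exact: val_inj.
  by case: (eqVneq k' j) => [<-//|kj]; rewrite Qk// eq_sym.
have -> : Q = Q *m axis_flip k' *m axis_flip k'.
  by rewrite -mulmxA axis_flipK mulmx1.
apply: PrM => //; apply: (IHm _ _ kdS); last exact/orthogonal_mxM/orthogonal_axis_flip.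
move=> i j; rewrite ltnS mulmx_axis_flip leq_eqVlt => /predU1P[ik|ik].
  have -> : i = k' by exact: val_inj.
  by case: (eqVneq j k') => [_|jk]; rewrite ?Qkk ?opprK ?Qk.
rewrite !fQ//; case: (eqVneq j k') => [->|//].
by rewrite -val_eqE /= ltn_eqF// oppr0.
Qed.

End OrthogonalGeneration.

(** * Independent standard normal families under moves of one or two coordinates *)

Section GaussianFamilies.
Context {R : realType} {disp : measure_display} {T : measurableType disp}.
Variable P : probability T R.
Local Notation TR := (measurableTypeR R).
Local Notation gauss := (@normal_prob R 0 1).

(* Equivalent to independence plus marginals: a factor is dropped by taking
   [B i = setT]. *)
Definition std_normal_family (I : finType) (Y : I -> T -> R) : Prop :=
  (forall i, measurable_fun [set: T] (Y i)) /\
  forall B : I -> set R, (forall i, measurable (B i)) ->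
    P (\bigcap_(i in [set: I]) (Y i @^-1` B i)) = (\prod_i gauss (B i))%E.

Lemma std_normal_familyP (I : finType) (Y : I -> T -> R) :
  std_normal_family Y <->
  [/\ forall i, measurable_fun [set: T] (Y i),
      forall i (B : set R), measurable B -> P (Y i @^-1` B) = gauss B
    & mutually_independent P Y].
Proof.
split=> [[mY lawY]|[mY lawY indY]]; last first.
  split=> // B mB.
  have -> : \bigcap_(i in [set: I]) (Y i @^-1` B i) =
      \bigcap_(i in [set` [set: I]%SET]) (Y i @^-1` B i).
    by apply: eq_bigcapl; split => k _ //=; rewrite inE.
  rewrite indY//; under eq_bigl do rewrite inE.
  by apply: eq_bigr => k _; exact: lawY.
have marg k (B : set R) : measurable B -> P (Y k @^-1` B) = gauss B.
  move=> mB; pose B' l := if l == k then B else setT.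
  have -> : Y k @^-1` B = \bigcap_(l in setT) (Y l @^-1` B' l).
    apply/seteqP; split=> [t Bt l _|t /(_ k Logic.I)]; rewrite /B' /=.
      by case: eqVneq => [->|].
    by rewrite eqxx.
  rewrite lawY => [|l]; last by rewrite /B'; case: ifP.
  rewrite (bigD1 k)//= {1}/B' eqxx big1 ?mule1// => l /negPf lk.
  by rewrite /B' lk probability_setT.
split => // J B mB.
pose B' l := if l \in J then B l else setT.
have -> : \bigcap_(l in [set` J]) (Y l @^-1` B l) =
    \bigcap_(l in setT) (Y l @^-1` B' l).
  apply/seteqP; split=> t Bt l /=; rewrite /B'.
    by move=> _; case: ifP => // lJ; exact: Bt.
  by move=> lJ; have := Bt l Logic.I; rewrite /= /B' lJ.
rewrite lawY => [|l]; last by rewrite /B'; case: ifP.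
rewrite [RHS]big_mkcond; apply: eq_bigr => l _; rewrite /B'.
by case: ifP => _; rewrite ?probability_setT// marg.
Qed.

Lemma measurable_finite_bigcap (I : finType) (F : I -> set T) :
  (forall i, measurable (F i)) -> measurable (\bigcap_(i in [set: I]) F i).
Proof.
by move=> mF; apply: fin_bigcap_measurable => [|i _//]; exact: finite_finset.
Qed.

(** The density is even and Lebesgue measure is invariant under negation. *)
Lemma normal_probN (A : set R) : measurable A ->
  gauss (-%R @^-1` A) = gauss A.
Proof.
move=> mA; pose f (x : TR) : \bar R := (normal_pdf 0 1 x)%:E.
have mN : measurable_fun [set: TR] (-%R : TR -> TR) by exact: oppr_measurable.
have mf : measurable_fun A f.
  by apply/measurable_EFinP/measurable_funTS; exact: measurable_normal_pdf.
have f0 : {in A, forall x, (0 <= f x)%E}.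
  by move=> x _; rewrite lee_fin normal_pdf_ge0.
rewrite /normal_prob.
transitivity (\int[lebesgue_measure]_(x in (-%R : TR -> TR) @^-1` A) (f \o -%R) x)%E.
  apply: eq_integral => x _; rewrite /f /= !normal_pdfE ?oner_eq0//.
  by rewrite /normal_fun !subr0 sqrrN.
rewrite -(ge0_integral_pushforward mN _ mA mf f0).
by apply: eq_measure_integral => B mB _; exact: lebesgue_measureN.
Qed.

Lemma std_normal_family_flip (I : finType) (Y : I -> T -> R) (a : I) :
  std_normal_family Y ->
  std_normal_family (fun i t => if i == a then - Y a t else Y i t).
Proof.
move=> [mY lawY]; split=> [i|B mB].
  by case: eqP => _ //; exact: measurableT_comp.
pose B' i := if i == a then -%R @^-1` B a else B i.
transitivity (P (\bigcap_(i in [set: I]) (Y i @^-1` B' i))).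
  congr (P _); apply: eq_bigcapr => i _; rewrite /B'.
  by case: eqVneq => [->|_].
rewrite lawY; last first.
  move=> i; rewrite /B'; case: ifP => // _.
  by rewrite -[X in measurable X]setTI; exact: oppr_measurable.
by apply: eq_bigr => i _; rewrite /B'; case: eqVneq => [->|//]; rewrite normal_probN.
Qed.

Section Pair.
Variables (I : finType) (Y : I -> T -> R) (a b : I) (B : I -> set R).
Hypotheses (YP : std_normal_family Y) (ab : a != b).
Hypothesis mB : forall i, measurable (B i).

(** The part of a box event that a rotation in the plane of [a] and [b] leaves untouched. *)
Let E : set T := \bigcap_(i in [set i | (i != a) && (i != b)]) (Y i @^-1` B i).

Let Z (t : T) : TR * TR := (Y a t, Y b t).

Let mE : measurable E.
Proof.
apply: fin_bigcap_measurable; first exact: finite_finset.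
by move=> i _; rewrite -[X in measurable X]setTI; apply: (YP.1 i).
Qed.

Let mZ : measurable_fun [set: T] Z.
Proof. by apply: measurable_fun_pair; [exact: (YP.1 a)|exact: (YP.1 b)]. Qed.

Lemma family_rectangle (A1 A2 : set R) : measurable A1 -> measurable A2 ->
  P (E `&` Z @^-1` (A1 `*` A2)) =
  (gauss A1 * (gauss A2 * \prod_(i | (i != a) && (i != b)) gauss (B i)))%E.
Proof.
move=> mA1 mA2; have ba : (b == a) = false by rewrite eq_sym (negPf ab).
pose B' i := if i == a then A1 else if i == b then A2 else B i.
have -> : E `&` Z @^-1` (A1 `*` A2) = \bigcap_(i in [set: I]) (Y i @^-1` B' i).
  apply/seteqP; split=> [t [Et [/= Za Zb]] i _|t Bt].
    rewrite /B' /=; case: eqVneq => [->//|ia]; case: eqVneq => [->//|ib].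
    by apply: Et; rewrite /= ia ib.
  split=> [i /andP[/negPf ia /negPf ib]|].
    by have := Bt i Logic.I; rewrite /B' /= ia ib.
  by have := (Bt a Logic.I, Bt b Logic.I); rewrite /B' /= eqxx ba eqxx; case.
rewrite YP.2; last by move=> i; rewrite /B'; case: ifP => // _; case: ifP.
rewrite (bigD1 a)//= (bigD1 b) 1?eq_sym//= {1 2}/B' !eqxx ba.
do 2 congr (_ * _)%E; apply: eq_bigr => i /andP[/negPf ia /negPf ib].
by rewrite /B' ia ib.
Qed.

(** A rotated rectangle is no longer a product of two sets, so the product formula must be extended
    from rectangles to all planar sets. Both sides are finite measures in [C] that agree on
    rectangles, which are stable under intersection and generate. *)
Lemma family_pair_law (C : set (TR * TR)) : measurable C ->
  P (E `&` Z @^-1` C) = (P E * (gauss \x gauss)%E C)%E.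
Proof.
move=> mC.
have PE : P E = (\prod_(i | (i != a) && (i != b)) gauss (B i))%E.
  have := family_rectangle measurableT measurableT.
  by rewrite setXTT preimage_setT setIT !probability_setT !mul1e.
have PE0 : 0 <= fine (P E) by rewrite fine_ge0.
(* [m1] is the planar Gaussian scaled by [P E]; [m2] is the image under [Z] of [P] restricted to
   [E]. *)
pose m1 := mscale (NngNum PE0) (gauss \x gauss)%E.
pose m2 := pushforward (mrestr P mE) Z.
rewrite setIC -[LHS]/(m2 C).
have -> : (P E * (gauss \x gauss) C)%E = m1 C.
  by rewrite /m1 /mscale /= fineK// fin_num_measure.
apply/esym/(measure_unique
  [set A1 `*` A2 | A1 in measurable & A2 in measurable] (fun=> setT)) => //.
- exact: measurable_prod_measurableType.
- move=> _ _ [A1 mA1 [A2 mA2 <-]] [A3 mA3 [A4 mA4 <-]]; rewrite -setXI.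
  exists (A1 `&` A3); first exact: measurableI.
  by exists (A2 `&` A4) => //; exact: measurableI.
- by move=> _; exists setT => //; exists setT => //; exact: setXTT.
- by rewrite bigcup_const.
- move=> _ [A1 mA1 [A2 mA2 <-]].
  rewrite /= /mscale /pushforward /mrestr setIC family_rectangle//.
  rewrite [X in (_ * X)%E = _](_ : _ = gauss A1 * gauss A2)%E; last first.
    exact: product_measure1E.
  rewrite [(NngNum PE0)%:num]/= fineK ?fin_num_measure// PE.
  by rewrite muleC muleA.
- have fin : (gauss \x gauss)%E [set: TR * TR] \is a fin_num.
    suff -> : (gauss \x gauss)%E [set: TR * TR] = (gauss setT * gauss setT)%E.
      by rewrite fin_numM// fin_num_measure.
    by rewrite -setXTT; exact: product_measure1E.
  by move=> _; rewrite /= /mscale -ge0_fin_numE//; exact: fin_numM.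
Qed.

Lemma std_normal_family_rotation (c s : R) : s != 0 -> c ^+ 2 + s ^+ 2 = 1 ->
  P (\bigcap_(i in [set: I]) ((fun t => if i == a then c * Y a t + s * Y b t
    else if i == b then - s * Y a t + c * Y b t else Y i t) @^-1` B i)) =
  (\prod_i gauss (B i))%E.
Proof.
move=> s0 cs; have ba : (b == a) = false by rewrite eq_sym (negPf ab).
rewrite (_ : \bigcap_(_ in _) _ = E `&` Z @^-1` (rotation c s @^-1` (B a `*` B b))).
  have mBab : measurable (B a `*` B b : set (TR * TR)).
    exact: (@measurableX _ _ TR TR _ _ (mB a) (mB b)).
  rewrite family_pair_law; last first.
    by rewrite -[X in measurable X]setTI; apply: measurable_rotation.
  rewrite gauss_prod_rotation// -family_pair_law// family_rectangle//.
  by rewrite [RHS](bigD1 a)//= [X in _ = (_ * X)%E](bigD1 b) 1?eq_sym.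
apply/seteqP; split=> [t Bt|t [Et [/= Za Zb]] i _].
  split=> [i /andP[/negPf ia /negPf ib]|].
    by have := Bt i Logic.I; rewrite /= ia ib.
  by have := (Bt a Logic.I, Bt b Logic.I); rewrite /= eqxx ba eqxx; case.
rewrite /=; case: eqVneq => [->//|ia]; case: eqVneq => [->//|ib].
by apply: Et; rewrite /= ia ib.
Qed.

End Pair.
End GaussianFamilies.

(** * Orthogonal action on one row of coordinates *)

Section RowAction.
Context {R : realType} {d : nat} {I : finType} (f : 'I_d -> I).

(* The right action of [Q] on the [f]-indexed coordinates of [y], read as a row
   vector; the other coordinates are kept. *)
Definition act (Q : 'M[R]_d) (y : I -> R) (i : I) : R :=
  if [pick j | f j == i] is Some j then \sum_l y (f l) * Q l j else y i.

Lemma act_out Q y i : (forall j, f j != i) -> act Q y i = y i.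
Proof. by move=> fi; rewrite /act; case: pickP => // j; rewrite (negPf (fi j)). Qed.

Hypothesis f_inj : injective f.

Lemma act_in Q y j : act Q y (f j) = \sum_l y (f l) * Q l j.
Proof.
rewrite /act; case: pickP => [k /eqP /f_inj ->//|/(_ j)].
by rewrite eqxx.
Qed.

Lemma act_case i : (exists j, i = f j) \/ (forall j, f j != i).
Proof.
have [j /eqP <-|fi] := pickP [pred j | f j == i]; first by left; exists j.
by right=> j; rewrite [f j == i]fi.
Qed.

Lemma act1 y : act 1%:M y = y.
Proof.
apply/funext => i; have [[j ->]|fi] := act_case i; last by rewrite act_out.
rewrite act_in; under eq_bigr do rewrite mxE.
by rewrite sum_mul_delta mulr1.
Qed.

Lemma actM A B y : act (A *m B) y = act B (act A y).
Proof.
apply/funext => i; have [[j ->]|fi] := act_case i; last by rewrite !act_out.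
rewrite !act_in; under eq_bigr do rewrite mxE mulr_sumr.
rewrite exchange_big; apply: eq_bigr => k _ /=.
rewrite act_in mulr_suml; apply: eq_bigr => l _; exact: mulrA.
Qed.

Lemma act_plane_rot y (a b : 'I_d) (c s : R) :
  act (plane_rot a b c s) y = fun i =>
    if i == f a then c * y (f a) + s * y (f b)
    else if i == f b then - s * y (f a) + c * y (f b) else y i.
Proof.
apply/funext => i; have [[j ->]|fi] := act_case i.
  by rewrite act_in (sum_mul_plane_rot (y \o f)) !(inj_eq f_inj).
by rewrite act_out// !(eq_sym i) !(negPf (fi _)).
Qed.

Lemma act_axis_flip y (a : 'I_d) :
  act (axis_flip R a) y = fun i => if i == f a then - y (f a) else y i.
Proof.
apply/funext => i; have [[j ->]|fi] := act_case i.
  by rewrite act_in (sum_mul_axis_flip (y \o f)) (inj_eq f_inj).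
by rewrite act_out// (eq_sym i) (negPf (fi _)).
Qed.

Lemma std_normal_family_act {disp : measure_display} {T : measurableType disp}
    (P : probability T R) (Q : 'M[R]_d) (Y : I -> T -> R) :
  orthogonal_mx Q -> std_normal_family P Y ->
  std_normal_family P (fun i t => act Q (Y^~ t) i).
Proof.
(* [Y] stays quantified: in the product case the claim for [B] is applied to the family already
   moved by [A]. *)
move=> hQ; move: Q hQ Y.
apply: orthogonal_generation.
- by move=> Y YP; under eq_fun do under eq_fun do rewrite act1.
- move=> A B IHA IHB Y /IHA /IHB.
  by under eq_fun do under eq_fun do rewrite -actM.
- move=> a b c s ab s0 cs Y YP.
  under eq_fun do under eq_fun do rewrite act_plane_rot.
  split=> [i|B mB].
    have mY j : measurable_fun [set: T] (Y j) := YP.1 j.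
    by case: eqP => _; [|case: eqP => _ //];
      apply: measurable_funD; apply: measurable_funM.
  by apply: std_normal_family_rotation => //; rewrite (inj_eq f_inj).
- move=> a Y YP; under eq_fun do under eq_fun do rewrite act_axis_flip.
  exact: std_normal_family_flip.
Qed.

End RowAction.

(** * Noise blocks multiplied by orthogonal matrices *)

Section GaussianBlocks.
Context {R : realType} {p d : nat} {n : 'I_p -> nat}.
Local Notation index := {i : 'I_p & ('I_(n i) * 'I_d)%type}.
Local Notation rows := {i : 'I_p & 'I_(n i)}.

Definition entries (T : Type) (W : T -> forall i, 'M[R]_(n i, d))
    (k : index) (t : T) : R := W t (tag k) (tagged k).1 (tagged k).2.

Lemma std_gaussian_blocksP {disp : measure_display} {T : measurableType disp}
    (P : probability T R) (W : T -> forall i, 'M[R]_(n i, d)) :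
  std_gaussian_blocks P W <-> std_normal_family P (entries W).
Proof. exact: iff_sym (std_normal_familyP _ _). Qed.

Definition row_index (x : rows) (j : 'I_d) : index :=
  Tagged (fun i => ('I_(n i) * 'I_d)%type) (tagged x, j).

Lemma row_index_inj x : injective (row_index x).
Proof.
by move=> j k /eqP; rewrite -tag_eqE /tag_eq /= eqxx tagged_asE => /eqP[].
Qed.

Lemma std_gaussian_blocks_mulmx {disp : measure_display}
    {T : measurableType disp} (P : probability T R)
    (W : T -> forall i, 'M[R]_(n i, d)) (Q : 'I_p -> 'M[R]_d) :
  (forall i, orthogonal_mx (Q i)) -> std_gaussian_blocks P W ->
  std_gaussian_blocks P (fun t i => W t i *m Q i).
Proof.
move=> hQ /std_gaussian_blocksP WP; apply/std_gaussian_blocksP.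
(* Rows are transformed one at a time: in [Y s] exactly the rows listed in [s] have been multiplied.
   As the enumeration has no repetition, each row is still the original one when its turn comes. *)
pose Y (s : seq rows) (k : index) (t : T) : R :=
  if Tagged (fun i => 'I_(n i)) (tagged k).1 \in s
  then entries (fun t i => W t i *m Q i) k t else entries W k t.
have -> : entries (fun t i => W t i *m Q i) = Y (enum {: rows}).
  by apply/funext => k; apply/funext => t; rewrite /Y mem_enum.
elim: (enum _) (enum_uniq {: rows}) => [|x s IHs] /=.
  by move=> _; have -> : Y [::] = entries W by [].
move=> /andP[xs /IHs] /(std_normal_family_act (@row_index_inj x) (hQ (tag x))).
congr (std_normal_family P); apply/funext => k; apply/funext => t.
have [[j ->]|kx] := act_case (row_index x) k.
  rewrite act_in; last exact: row_index_inj.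
  rewrite /Y /entries /=; case: x xs => i a /= xs; rewrite inE eqxx /= mxE.
  by apply: eq_bigr => l _; rewrite (negPf xs).
rewrite act_out// /Y inE; case: eqVneq => // kE.
case: k kx kE => i [a j] /= kx kE; have := kx j.
by rewrite /row_index -kE eqxx.
Qed.

End GaussianBlocks.

(** * Laws of random matrices are determined by boxes *)

Section MatrixLaw.
Context {R : realType} {m d : nat}.

Definition mx_box (B : 'I_m -> 'I_d -> set R) : set 'M[R]_(m, d) :=
  [set M | forall i j, B i j (M i j)].

(** Replaces the generators constraining a single entry by a family stable under intersection, as
    uniqueness of measures requires. *)
Definition mx_boxes : set (set 'M[R]_(m, d)) :=
  [set mx_box B | B in [set B | forall i j, measurable (B i j)]].

Lemma mx_measurable_boxes (C : set 'M[R]_(m, d)) :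
  mx_measurable C -> <<s mx_boxes >> C.
Proof.
apply: smallest_sub; first exact: smallest_sigma_algebra.
move=> _ [i [j [B [mB ->]]]]; apply: sub_sigma_algebra.
exists (fun k l => if (k == i) && (l == j) then B else setT).
  by move=> k l; case: ifP.
apply/seteqP; split=> [M /(_ i j)|M BM k l]; rewrite /= ?eqxx//.
by case: ifP => // /andP[/eqP -> /eqP ->].
Qed.

Lemma mx_boxes_setI : setI_closed mx_boxes.
Proof.
move=> _ _ [B mB <-] [C mC <-].
exists (fun i j => B i j `&` C i j); first by move=> i j; exact: measurableI.
apply/seteqP; split=> M; first by move=> BM; split=> i j; have [] := BM i j.
by case=> BM CM i j; split; [exact: BM|exact: CM].
Qed.

Lemma eq_distribution_boxes (d1 d2 : measure_display)
    (T1 : measurableType d1) (T2 : measurableType d2)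
    (P1 : probability T1 R) (P2 : probability T2 R)
    (Z1 : T1 -> 'M[R]_(m, d)) (Z2 : T2 -> 'M[R]_(m, d)) :
  (forall i j, measurable_fun [set: T1] (fun t => Z1 t i j)) ->
  (forall i j, measurable_fun [set: T2] (fun t => Z2 t i j)) ->
  (forall B, (forall i j, measurable (B i j)) ->
    P1 (Z1 @^-1` mx_box B) = P2 (Z2 @^-1` mx_box B)) ->
  eq_distribution P1 P2 Z1 Z2.
Proof.
move=> mZ1 mZ2 P12 C /mx_measurable_boxes mC.
pose M := g_sigma_algebraType mx_boxes.
have mZ (d' : measure_display) (T' : measurableType d') (Z : T' -> M) :
    (forall i j, measurable_fun [set: T'] (fun t => (Z t : 'M[R]_(m, d)) i j)) ->
    measurable_fun [set: T'] Z.
  move=> mZ; apply: (@measurability _ _ _ M _ _ mx_boxes erefl) => _ [_ [B mB <-] <-].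
  rewrite setTI (_ : _ @^-1` _ =
    \bigcap_(ij in [set: 'I_m * 'I_d]) ((fun t => Z t ij.1 ij.2) @^-1` B ij.1 ij.2)).
    apply: measurable_finite_bigcap => -[i j] /=.
    by rewrite -[X in measurable X]setTI; exact: mZ.
  by apply/seteqP; split=> t BZ; [move=> [i j] _|move=> i j; exact: (BZ (i, j))].
have mZ1' := mZ _ _ (Z1 : T1 -> M) mZ1.
have mZ2' := mZ _ _ (Z2 : T2 -> M) mZ2.
rewrite -[LHS]/(pushforward P1 (Z1 : T1 -> M) C).
rewrite -[RHS]/(pushforward P2 (Z2 : T2 -> M) C).
apply: (@measure_unique _ _ M mx_boxes (fun=> setT)) => //.
- exact: mx_boxes_setI.
- move=> _; exists (fun _ _ => setT) => //.
  by apply/seteqP; split.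
- by rewrite bigcup_const.
- by move=> _ [B mB <-]; exact: P12.
- by move=> _; rewrite /= /pushforward preimage_setT probability_setT ltry.
Qed.

End MatrixLaw.

(** * The law of the collaboration matrix as a function of the noise law *)

Section CollaborationLaw.
Context {R : realType} {p d : nat} {n : 'I_p -> nat}.
Variables (sigma : R) (X : forall i, 'M[R]_(n i, d)) (O : 'M[R]_d).
Variable Psi : 'cV[R]_d.

Definition noiseless (i : 'I_p) : 'M[R]_(n i, d) :=
  X i *m O + ones R (n i) *m Psi^T.

Definition noisy (k : {i : 'I_p & ('I_(n i) * 'I_d)%type}) (x : R) : R :=
  noiseless (tag k) (tagged k).1 (tagged k).2 + sigma * x.

Lemma measurable_noisy k : measurable_fun [set: R] (noisy k).
Proof. by apply: measurable_funD => //; exact: measurable_funM. Qed.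

Lemma Z_C_entry (W : forall i, 'M[R]_(n i, d)) x j :
  Z_C sigma X O Psi W x j =
  noisy (row_index (tagnat.sig x) j)
    (W (tag (tagnat.sig x)) (tagged (tagnat.sig x)) j).
Proof. by rewrite /Z_C /mxcol !mxE /noisy /noiseless /= !mxE. Qed.

(** Each entry is an affine function of its own noise entry, so a box event for the matrix is a box
    event for the noise, with a probability depending only on the box. Taking preimages instead of
    dividing by [sigma] covers [sigma = 0]. *)
Lemma Z_C_law {disp disp' : measure_display} {T : measurableType disp}
    {T' : measurableType disp'} (P : probability T R) (P' : probability T' R)
    (W : T -> forall i, 'M[R]_(n i, d)) (W' : T' -> forall i, 'M[R]_(n i, d)) :
  std_gaussian_blocks P W -> std_gaussian_blocks P' W' ->
  eq_distribution P P' (fun t => Z_C sigma X O Psi (W t))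
    (fun t => Z_C sigma X O Psi (W' t)).
Proof.
have mZ (d' : measure_display) (S : measurableType d') (Q : probability S R)
    (V : S -> forall i, 'M[R]_(n i, d)) : std_gaussian_blocks Q V ->
    forall i j, measurable_fun [set: S] (fun t => Z_C sigma X O Psi (V t) i j).
  move=> /std_gaussian_blocksP[mV _] x j; under eq_fun do rewrite Z_C_entry.
  apply: (measurableT_comp (measurable_noisy _)).
  exact: (mV (row_index (tagnat.sig x) j)).
pose D (B : 'I_(\sum_i n i) -> 'I_d -> set R)
    (k : {i : 'I_p & ('I_(n i) * 'I_d)%type}) : set R :=
  noisy k @^-1` B (tagnat.rank (Tagged (fun i => 'I_(n i)) (tagged k).1)) (tagged k).2.
have box (d' : measure_display) (S : measurableType d') (Q : probability S R)
    (V : S -> forall i, 'M[R]_(n i, d)) B : std_gaussian_blocks Q V ->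
    (forall i j, measurable (B i j)) ->
    Q ((fun t => Z_C sigma X O Psi (V t)) @^-1` mx_box B) =
    (\prod_k normal_prob 0 1 (D B k))%E.
  move=> /std_gaussian_blocksP[_ lawV] mB; rewrite -lawV; last first.
    by move=> k; rewrite -[X in measurable X]setTI; exact: measurable_noisy.
  congr (Q _); apply/seteqP; split=> [t BV [i [a j]] _|t BV x j].
    have := BV (tagnat.rank (Tagged (fun i => 'I_(n i)) a)) j.
    by rewrite Z_C_entry tagnat.rankK.
  rewrite Z_C_entry; have := BV (row_index (tagnat.sig x) j) Logic.I.
  (* Writing [x] as the rank of its block and row lets both sides match once that pair is
     destructed. *)
  rewrite /D /= -[X in _ -> B X _ _]tagnat.sigK.
  by rewrite /entries /=; case: (tagnat.sig x).
move=> WP WP'; apply: eq_distribution_boxes; [exact: mZ WP|exact: mZ WP'|].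
by move=> B mB; rewrite (box _ _ _ _ _ WP)// (box _ _ _ _ _ WP').
Qed.

End CollaborationLaw.

(** * Equality in law deduced from the coupling *)

Theorem corollary3p3 (R : realType) (p d r : nat) (n : 'I_p -> nat)
    (X : forall i : 'I_p, 'M[R]_(n i, d)) (A : 'M[R]_(r, d))
    (hA : \rank (center_cols A) = d)
    (sigma : R) (hsigma : 0 <= sigma) (s : 'I_p)
    (O : 'I_p -> 'M[R]_d) (hO : forall i, orthogonal_mx (O i))
    (Psi : 'I_p -> 'cV[R]_d)
    (U S V : 'I_p -> 'M[R]_d)
    (hSVD : analyst_svds s (fun i => anchor_share A (O i) (Psi i)) U S V)
    (disp : measure_display) (T : measurableType disp) (P : probability T R)
    (W : T -> forall i : 'I_p, 'M[R]_(n i, d))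
    (hW : std_gaussian_blocks P W) :
  (forall (disp' : measure_display) (T' : measurableType disp')
      (P' : probability T' R) (WC : T' -> forall i : 'I_p, 'M[R]_(n i, d)),
    std_gaussian_blocks P' WC ->
    eq_distribution P P'
      (fun t => Z_AA s sigma X A O Psi U V (W t))
      (fun t' => Z_C sigma X (O s) (Psi s) (WC t')))
  /\
  (let Wtilde := fun (t : T) (i : 'I_p) => W t i *m (O i)^T *m O s in
   std_gaussian_blocks P Wtilde /\
   forall t : T,
     Z_AA s sigma X A O Psi U V (W t) = Z_C sigma X (O s) (Psi s) (Wtilde t)).
Proof.
have coupling t := Z_AA_coupling sigma X (W t) hA hO hSVD.
have hQ i : orthogonal_mx ((O i)^T *m O s).
  exact/orthogonal_mxM/hO/orthogonal_mxT/hO.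
have WP : std_gaussian_blocks P (fun t i => W t i *m (O i)^T *m O s).
  move: (std_gaussian_blocks_mulmx hQ hW); congr std_gaussian_blocks.
  by apply/funext => t; apply: functional_extensionality_dep => i; rewrite mulmxA.
split=> [disp' T' P' WC WCP|]; last by split.
(* The coupling turns the aligned matrix into a C-GDP matrix with Gaussian noise, so two C-GDP laws
   remain to be compared, possibly on different probability spaces. *)
rewrite (funext coupling); exact: Z_C_law.
Qed.
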